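(* Let $G_0=(V_0,E_0)$ be a $\phi$-expander with $m$ edges, $n$ vertices and minimum degree $\delta$. For $S\subseteq V_0$ let $\mathsf{vol}_0(S)$ be its volume in $G_0$. Consider a sequence of adversarial edge deletions, where at step $t\ge1$ an edge $e_t\in E_{t-1}$ of the current graph $G_{t-1}=(V_{t-1},E_{t-1})$ is deleted, and the procedure \textsc{Prune} produces $G_t$ as follows: set $E_t\leftarrow E_{t-1}\setminus\{e_t\}$, $V_t\leftarrow V_{t-1}$; while there is a subset $A\subseteq V_t$, taken to be the smaller side of the cut, with $|E_t(A,V_t\setminus A)|<(\phi/6)\cdot\mathsf{vol}_0(A)$, remove $A$ (set $V_t\leftarrow V_t\setminus A$ and $E_t\leftarrow$ the edges of $E_t$ with both endpoints in the new $V_t$). Let $P_t=V_0\setminus V_t$ be the set of vertices pruned during the first $t$ deletions. Then for each $1\le t\le \phi^2m/20$: (i) $P_t\subseteq P_{t+1}$; (ii) for every $A\subseteq V_t$, $|E_t(A,V_t\setminus A)|\ge(\phi/6)\min(\mathsf{vol}_0(A),\mathsf{vol}_0(V_t\setminus A))$, and hence every vertex of $V_t$ has degree at least $\phi\delta/6$ in $G_t$; (iii) $\mathsf{vol}_0(P_t)\le 6t/(5\phi)$.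
   Context: For an undirected graph and $S\subseteq V$, $\mathsf{vol}(S)=\sum_{v\in S}\deg(v)$, and $E(S,T)$ denotes the set of edges with one endpoint in $S$ and one in $T$. A graph $G=(V,E)$ is a $\phi$-expander if $|E(S,V\setminus S)|\ge\phi\min(\mathsf{vol}(S),\mathsf{vol}(V\setminus S))$ for all $S\subseteq V$. Here $\mathsf{vol}_0$ always refers to degrees in the initial graph $G_0$. *)

(* Defs.v *)
From mathcomp Require Import all_boot all_order all_algebra.

Set Implicit Arguments.
Unset Strict Implicit.
Unset Printing Implicit Defensive.

Import Order.TTheory GRing.Theory Num.Theory.
Local Open Scope ring_scope.

(* A finite simple undirected graph whose vertices are drawn from [T]; an edge
   is the two-element set of its endpoints. *)
Record graph (T : finType) := Graph {
  vset : {set T};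
  eset : {set {set T}};
  graphP : eset \subset [set e : {set T} | (e \subset vset) && (#|e| == 2%N)]
}.

Section GraphNotions.
Variables (T : finType) (G : graph T).
Implicit Types (S A : {set T}) (e : {set T}) (v : T).

Definition deg v : nat := #|[set e in eset G | v \in e]|.

Definition vol S : nat := (\sum_(v in S) deg v)%N.

Definition edges_between S A : {set {set T}} :=
  [set e in eset G | [exists u in S, exists v in A, e == [set u; v]]].

Definition min_degree (d : nat) : Prop :=
  (exists2 v, v \in vset G & deg v = d) /\
  (forall v, v \in vset G -> (d <= deg v)%N).

Definition expander (R : realFieldType) (phi : R) : Prop :=
  forall S, S \subset vset G ->
    phi * (minn (vol S) (vol (vset G :\: S)))%:R
      <= #|edges_between S (vset G :\: S)|%:R.

Fact delete_edge_subproof e :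
  eset G :\ e \subset [set f : {set T} | (f \subset vset G) && (#|f| == 2%N)].
Proof. exact: subset_trans (subsetDl _ _) (graphP G). Qed.

Definition delete_edge e : graph T := Graph (delete_edge_subproof e).

Fact remove_vertices_subproof A :
  [set f in eset G | f \subset vset G :\: A]
    \subset [set f : {set T} | (f \subset vset G :\: A) && (#|f| == 2%N)].
Proof.
apply/subsetP => f; rewrite !inE => /andP[fG ->] /=.
by have := subsetP (graphP G) _ fG; rewrite inE => /andP[].
Qed.

Definition remove_vertices A : graph T := Graph (remove_vertices_subproof A).

End GraphNotions.

Section Prune.
Variables (T : finType) (R : realFieldType) (phi : R) (G0 : graph T).
Implicit Types (G H : graph T) (A : {set T}).

(* The "smaller side" of a cut is the one of smaller volume in [G0]; on a tie
   either side qualifies. *)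
Definition prunable G A : Prop :=
  [/\ A \subset vset G,
      (vol G0 A <= vol G0 (vset G :\: A))%N
    & #|edges_between G A (vset G :\: A)|%:R < phi / 6 * (vol G0 A)%:R].

(* [prune_loop G H]: the while loop started in state [G] can exit in state [H].
   It is a relation because the choice of [A] in each iteration is free. *)
Inductive prune_loop : graph T -> graph T -> Prop :=
| prune_exit G : (forall A, ~ prunable G A) -> prune_loop G G
| prune_iter G A H :
    prunable G A -> prune_loop (remove_vertices G A) H -> prune_loop G H.

(* [k] deletion steps: [e t] is the [t]-th deleted edge ([e 0] is unused) and
   [G t] is the graph after the [t]-th call; values beyond [k] are irrelevant. *)
Definition prune_run (k : nat) (e : nat -> {set T}) (G : nat -> graph T)
    : Prop :=
  G 0%N = G0 /\
  forall t, (1 <= t <= k)%N ->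
    e t \in eset (G t.-1) /\ prune_loop (delete_edge (G t.-1) (e t)) (G t).

End Prune.

Definition pruned (T : finType) (G : nat -> graph T) (t : nat) : {set T} :=
  vset (G 0%N) :\: vset (G t).

(* Main.v *)
(** Call an edge of [G0] lost if it meets the surviving vertices but is no
    longer present. Deleting an edge loses at most one edge, and pruning [A]
    loses at most the current cut of [A], which is charged to the volume of
    [A]; so after [t] deletions at most [phi/6 * vol P + t] edges are lost,
    where [P] is the set of pruned vertices. The [G0]-cut of [P] consists of lost
    edges, so if [vol P] is at most half of the total volume, expansion gives
    [vol P <= 6 t / (5 phi)]. This is at most 3 percent of the total volume, and
    as a smaller side is pruned, [vol P] cannot jump from there beyond one half:
    the cut would then be far too large for the number of lost edges. *)
Require Import Defs.
From mathcomp Require Import all_boot all_order all_algebra.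
From mathcomp Require Import zify lra.

Set Implicit Arguments.
Unset Strict Implicit.
Unset Printing Implicit Defensive.

Import Order.TTheory GRing.Theory Num.Theory.
Local Open Scope ring_scope.

(** * Edges, cuts and volumes in a single graph *)

Section Graphs.
Variables (T : finType) (G : graph T).
Implicit Types (S A : {set T}) (e : {set T}) (v : T).

Lemma edge_sub e : e \in eset G -> e \subset vset G.
Proof. by move=> /(subsetP (graphP G)); rewrite inE => /andP[]. Qed.

Lemma edge_card e : e \in eset G -> #|e| = 2%N.
Proof. by move=> /(subsetP (graphP G)); rewrite inE => /andP[_ /eqP]. Qed.

Lemma edges_betweenC S A : edges_between G S A = edges_between G A S.
Proof.
apply/setP => e; rewrite !inE; congr andb.
by apply/exists_inP/exists_inP => -[u uS /exists_inP[v vA /eqP->]];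
  exists v => //; apply/exists_inP; exists u => //; rewrite setUC.
Qed.

Lemma mem_edges_between e u v S A :
  e \in eset G -> u \in e -> v \in e -> u != v -> u \in S -> v \in A ->
  e \in edges_between G S A.
Proof.
move=> eG ue ve uv uS vA; rewrite inE eG; apply/exists_inP; exists u => //.
apply/exists_inP; exists v => //.
by rewrite eq_sym eqEcard subUset !sub1set ue ve cards2 uv (edge_card eG).
Qed.

Lemma card_edges_between1 v A : (#|edges_between G [set v] A| <= deg G v)%N.
Proof.
apply/subset_leq_card/subsetP => e; rewrite !inE => /andP[->].
by move=> /exists_inP[u /set1P-> /exists_inP[w _ /eqP->]]; rewrite set21.
Qed.

Lemma vol1 v : vol G [set v] = deg G v.
Proof. exact: big_set1. Qed.

Lemma volDl A S : A \subset S -> (vol G A + vol G (S :\: A))%N = vol G S.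
Proof. by move=> AS; rewrite [RHS](big_setID A) /= (setIidPr AS). Qed.

Lemma leq_deg_card v : (deg G v <= #|eset G|)%N.
Proof. by apply/subset_leq_card/subsetP => e; rewrite inE => /andP[]. Qed.

Lemma handshake : vol G (vset G) = (2 * #|eset G|)%N.
Proof.
have degE v : deg G v = (\sum_(e in eset G) (v \in e))%N.
  rewrite /deg -sum1_card (eq_bigl _ _ (fun e => in_set _ e)) big_mkcondr.
  by apply: eq_bigr => e _; case: (v \in e).
rewrite /vol (eq_bigr _ (fun v _ => degE v)) exchange_big /= mulnC -sum_nat_const.
apply: eq_bigr => e eG; rewrite -(edge_card eG) -sum1_card big_mkcond /=.
rewrite [RHS]big_mkcond; apply: eq_bigr => v _.
by case ve: (v \in e); rewrite ?(subsetP (edge_sub eG) _ ve) ?if_same.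
Qed.

(** Test expansion on one endpoint [u] of an edge: [deg G u] is at most half of the total volume
    [2 * #|eset G|], and the cut around [u] has at most [deg G u] edges. *)
Lemma expander_le1 (R : realFieldType) (phi : R) :
  expander G phi -> (0 < #|eset G|)%N -> phi <= 1.
Proof.
move=> expG /card_gt0P[e eG].
have /card_gt0P[u ue] : (0 < #|e|)%N by rewrite (edge_card eG).
have uG : [set u] \subset vset G by rewrite sub1set (subsetP (edge_sub eG)).
have deg_gt0 : (0 < deg G u)%N by apply/card_gt0P; exists e; rewrite inE eG.
have := expG _ uG; have := volDl uG; rewrite handshake vol1 => volE.
have /minn_idPl-> : (deg G u <= vol G (vset G :\: [set u]))%N.
  by have := leq_deg_card u; lia.
move=> phi_deg; rewrite -(ler_pM2r (_ : 0 < (deg G u)%:R)) ?ltr0n // mul1r.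
by apply: le_trans phi_deg _; rewrite ler_nat card_edges_between1.
Qed.

End Graphs.

(** * Lost edges and the volume of the pruned set *)

Section Pruning.
Variables (T : finType) (R : realFieldType) (phi : R) (G0 : graph T).
Implicit Types (G H : graph T) (A : {set T}) (e : {set T}) (v : T) (t : nat).

(** Edges with both ends pruned are left out, so that removing [A] costs only its cut and not the
    edges inside [A]. *)
Definition lost_edges G : {set {set T}} :=
  [set e in eset G0 | (e \notin eset G) && ~~ [disjoint e & vset G]].

Lemma lost_edges_delete G e :
  (#|lost_edges (delete_edge G e)| <= #|lost_edges G| + 1)%N.
Proof.
apply: leq_trans (_ : #|e |: lost_edges G| <= _)%N; last first.
  by rewrite cardsU1 addnC leq_add2l leq_b1.
apply/subset_leq_card/subsetP => f; rewrite !inE negb_and negbK.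
by case/and3P=> -> /orP[->|->] ->; rewrite ?orbT.
Qed.

(** A newly lost edge was present in [G] and keeps a surviving end [v], so its other end [u] lies in
    [A] and the edge crosses the cut. *)
Lemma lost_edges_remove G A :
  (#|lost_edges (remove_vertices G A)|
     <= #|lost_edges G| + #|edges_between G A (vset G :\: A)|)%N.
Proof.
apply: leq_trans (leq_card_setU _ _); apply/subset_leq_card/subsetP => f.
rewrite inE => /and3P[fG0 fGA].
rewrite -setI_eq0 => /set0Pn[v /setIP[vf vGA]].
have [fG|fG] := boolP (f \in eset G); last first.
  apply/setUP; left; rewrite inE fG0 fG /= -setI_eq0; apply/set0Pn; exists v.
  by rewrite inE vf; case/setDP: vGA.
move: fGA; rewrite inE fG /= => /subsetPn[u uf uGA].
have uG := subsetP (edge_sub fG) _ uf.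
have uA : u \in A by move: uGA; rewrite inE uG andbT negbK.
have uv : u != v by apply: contraNneq uGA => ->.
by apply/setUP; right; apply: mem_edges_between fG uf vf uv uA vGA.
Qed.

Lemma cut_sub_lost_edges G :
  vset G \subset vset G0 ->
  edges_between G0 (vset G0 :\: vset G) (vset G) \subset lost_edges G.
Proof.
move=> GG0; apply/subsetP => f; rewrite !inE => /andP[fG0].
case/exists_inP=> u /setDP[_ uG] /exists_inP[v vG /eqP fE]; rewrite fG0 /=.
apply/andP; split.
  by apply: contra uG => /edge_sub/subsetP; apply; rewrite fE set21.
by rewrite -setI_eq0; apply/set0Pn; exists v; rewrite inE fE set22.
Qed.

Lemma prune_loop_subset G H : prune_loop phi G0 G H -> vset H \subset vset G.
Proof.
elim=> // {}G A {}H _ _ sHG; exact: subset_trans sHG (subsetDl _ _).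
Qed.

Lemma prune_loop_exit G H : prune_loop phi G0 G H -> forall A, ~ prunable phi G0 H A.
Proof. by elim. Qed.

Lemma unprunable_cut G A :
  (forall B, ~ prunable phi G0 G B) -> A \subset vset G ->
  phi / 6 * (minn (vol G0 A) (vol G0 (vset G :\: A)))%:R
    <= #|edges_between G A (vset G :\: A)|%:R.
Proof.
move=> noprune AG; have KA : vset G :\: (vset G :\: A) = A.
  by rewrite setDDr setDv set0U (setIidPr AG).
case: leqP => [leA|/ltnW leA]; rewrite leNgt; apply/negP => cut_lt.
  exact: (noprune A).
by apply: (noprune (vset G :\: A)); split; rewrite ?subsetDl ?KA // edges_betweenC.
Qed.

Hypotheses (phi_gt0 : 0 < phi) (expG0 : expander G0 phi).
Let m := #|eset G0|.

(** The second clause makes the pruned set the smaller side in [G0], so that expansion bounds its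
    volume; the third charges lost edges to pruned volume and to the [t] deletions. *)
Definition prune_invariant t G : Prop :=
  [/\ vset G \subset vset G0,
      (vol G0 (vset G0 :\: vset G) <= vol G0 (vset G))%N
    & #|lost_edges G|%:R <= phi / 6 * (vol G0 (vset G0 :\: vset G))%:R + t%:R].

Lemma vol_pruned G : vset G \subset vset G0 ->
  (vol G0 (vset G0 :\: vset G))%:R + (vol G0 (vset G))%:R = 2 * m%:R :> R.
Proof.
by move=> GG0; rewrite -natrD addnC volDl // handshake natrM.
Qed.

Lemma expander_lost_edges G : vset G \subset vset G0 ->
  phi * (minn (vol G0 (vset G0 :\: vset G)) (vol G0 (vset G)))%:R
    <= #|lost_edges G|%:R.
Proof.
move=> GG0; have := expG0 (subsetDl (vset G0) (vset G)).
have -> : vset G0 :\: (vset G0 :\: vset G) = vset G.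
  by rewrite setDDr setDv set0U (setIidPr GG0).
move=> /le_trans; apply; rewrite ler_nat.
exact/subset_leq_card/cut_sub_lost_edges.
Qed.

(** With [p] the pruned volume, expansion and the charge give [phi * p <= phi / 6 * p + t]; the
    factor [6 / 5] comes from [1 - 1 / 6]. *)
Lemma prune_invariant_vol t G : prune_invariant t G ->
  phi * (vol G0 (vset G0 :\: vset G))%:R <= 6 / 5 * t%:R.
Proof.
case=> GG0 half lost; have := expander_lost_edges GG0.
rewrite (minn_idPl half) => /le_trans/(_ lost); lra.
Qed.

Lemma prune_invariant_vol_small t G :
  t%:R <= phi * m%:R / 20 -> prune_invariant t G ->
  (vol G0 (vset G0 :\: vset G))%:R <= 6 / 100 * m%:R :> R.
Proof.
move=> t_le /prune_invariant_vol volP.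
rewrite -(ler_pM2l phi_gt0); lra.
Qed.

Lemma prune_invariant_delete t G e :
  prune_invariant t G -> prune_invariant t.+1 (delete_edge G e).
Proof.
case=> GG0 half lost; split=> //.
have := lost_edges_delete G e; rewrite -(ler_nat R) natrD => /le_trans; apply.
by rewrite -[t.+1]addn1 natrD addrA lerD2r.
Qed.

Lemma prune_invariant_remove t G A :
  (0 < m)%N -> t%:R <= phi * m%:R / 20 ->
  prunable phi G0 G A -> prune_invariant t G ->
  prune_invariant t (remove_vertices G A).
Proof.
move=> m_gt0 t_le [AG small cut] inv; have p_le := prune_invariant_vol_small t_le inv.
case: inv => GG0 half lost.
have GAG0 : vset G :\: A \subset vset G0 by apply: subset_trans GG0; exact: subsetDl.
have volE := vol_pruned GG0.
have volE' := vol_pruned (G := remove_vertices G A) GAG0.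
have volA := volDl G0 AG.
have lost' : #|lost_edges (remove_vertices G A)|%:R
    <= phi / 6 * (vol G0 (vset G0 :\: (vset G :\: A)))%:R + t%:R.
  have := lost_edges_remove G A; rewrite -(ler_nat R) natrD => /le_trans; apply.
  have -> : (vol G0 (vset G0 :\: (vset G :\: A)))%:R
      = (vol G0 (vset G0 :\: vset G))%:R + (vol G0 A)%:R :> R.
    (* Both sides complement the same surviving volume to [2 * m]. *)
    by apply: (addIr (vol G0 (vset G :\: A))%:R); rewrite volE' -addrA -natrD volA.
  lra.
(* If the pruned side became the larger one, expansion would apply to the surviving side instead. *)
split=> //=; rewrite leqNgt; apply/negP => big.
have := expander_lost_edges (G := remove_vertices G A) GAG0.
rewrite /= (minn_idPr (ltnW big)) => /le_trans/(_ lost').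
move: p_le volE volE'; rewrite -volA natrD; move: small; rewrite -(ler_nat R).
have m_pos : 0 < m%:R :> R by rewrite ltr0n.
move: (vol G0 A)%:R (vol G0 (vset G :\: A))%:R (vol G0 (vset G0 :\: vset G))%:R
  (vol G0 (vset G0 :\: (vset G :\: A)))%:R => a w p q a_le p_le volE volE' contra.
(* As [a <= w] and [p <= 6 / 100 * m], the total [p + a + w = 2 * m] gives [w >= 97 / 100 * m],
   hence [q <= 103 / 100 * m]. Then [phi * w] exceeds [phi / 6 * q + t], which is below
   [phi * m / 4]. The products with [phi] are supplied to make this linear. *)
have w_ge : 97 / 100 * m%:R <= w by lra.
have phi_w := ler_wpM2l (ltW phi_gt0) w_ge.
have phi_q : phi * q = phi * (2 * m%:R - w) by rewrite -volE' addrK.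
have phi_m : 0 < phi * m%:R by rewrite mulr_gt0.
lra.
Qed.

Lemma prune_invariant_loop t G H :
  (0 < m)%N -> t%:R <= phi * m%:R / 20 ->
  prune_loop phi G0 G H -> prune_invariant t G -> prune_invariant t H.
Proof.
move=> m_gt0 t_le; elim=> // {}G A {}H prA _ IH inv.
exact/IH/prune_invariant_remove.
Qed.

Lemma prune_invariant_run k (e : nat -> {set T}) (G : nat -> graph T) t :
  (0 < m)%N -> prune_run phi G0 k e G -> (t <= k)%N ->
  t%:R <= phi * m%:R / 20 -> prune_invariant t (G t).
Proof.
move=> m_gt0 [G00 step]; elim: t => [|t IH] t_le_k t_le.
  rewrite G00; split; rewrite // setDv /vol big_set0 // mulr0 addr0.
  suff -> : lost_edges G0 = set0 by rewrite cards0.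
  by apply/setP => f; rewrite !inE; case: (f \in _).
have [_ loop] := step t.+1 t_le_k.
apply: prune_invariant_loop loop _ => //; apply/prune_invariant_delete/IH.
  exact: ltnW.
by apply: le_trans t_le; rewrite ler_nat.
Qed.

End Pruning.

Theorem theorem3p5 (R : realFieldType) (T : finType) (phi : R) (G0 : graph T)
    (m n delta : nat)
    (phi_gt0 : 0 < phi)
    (expG0 : expander G0 phi)
    (card_edges : #|eset G0| = m)
    (card_vertices : #|vset G0| = n)
    (min_deg : min_degree G0 delta)
    (k : nat) (e : nat -> {set T}) (G : nat -> graph T)
    (run : prune_run phi G0 k e G)
    (t : nat) (t_ge1 : (1 <= t)%N) (t_le_k : (t <= k)%N)
    (t_bound : t%:R <= phi ^+ 2 * m%:R / 20) :
  [/\ (t < k)%N -> pruned G t \subset pruned G t.+1,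
      (forall A : {set T}, A \subset vset (G t) ->
         phi / 6 * (minn (vol G0 A) (vol G0 (vset (G t) :\: A)))%:R
           <= #|edges_between (G t) A (vset (G t) :\: A)|%:R) /\
      (forall v : T, v \in vset (G t) ->
         phi * delta%:R / 6 <= (deg (G t) v)%:R)
    & (vol G0 (pruned G t))%:R <= 6 * t%:R / (5 * phi)].
Proof.
have m_gt0 : (0 < m)%N.
  rewrite lt0n; apply/eqP => m0; move: t_bound.
  by rewrite m0 mulr0 mul0r lern0 eqn0Ngt t_ge1.
(* Since [phi <= 1], the bound with [phi ^+ 2] implies the one with [phi] that the invariant
   needs. *)
subst m; have t_le : t%:R <= phi * #|eset G0|%:R / 20.
  apply: le_trans t_bound _; rewrite ler_pM2r ?invr_gt0 ?ltr0n //.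
  rewrite ler_wpM2r ?ler0n // expr2 ger_pMr //; exact: expander_le1 expG0 m_gt0.
have inv := prune_invariant_run phi_gt0 expG0 m_gt0 run t_le_k t_le.
have [GG0 _ _] := inv; have [G00 step] := run.
have cutP (A : {set T}) : A \subset vset (G t) ->
    phi / 6 * (minn (vol G0 A) (vol G0 (vset (G t) :\: A)))%:R
      <= #|edges_between (G t) A (vset (G t) :\: A)|%:R.
  have [|_ loop] := step t; first by rewrite t_ge1.
  exact/unprunable_cut/(prune_loop_exit loop).
have volP := prune_invariant_vol expG0 inv.
split; last 1 first.
- rewrite /pruned G00 ler_pdivlMr ?mulr_gt0 //; lra.
- move=> lt_tk; have [_ loop] := step t.+1 lt_tk.
  exact: setDS (prune_loop_subset loop).
split=> // v vGt; have v1 : [set v] \subset vset (G t) by rewrite sub1set.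
have [_ deg_ge] := min_deg.
(* To get [delta] from the cut bound at [[set v]], both sides of the cut need volume at least
   [delta]. The surviving volume is at least [194 / 100 * m] and [v] accounts for at most [m] of it,
   so another vertex [u] survives, and its degree in [G0] suffices. *)
have delta_le : (delta <= vol G0 (vset (G t) :\: [set v]))%N.
  have : (0 < vol G0 (vset (G t) :\: [set v]))%N.
    have P_small := prune_invariant_vol_small phi_gt0 expG0 t_le inv.
    have := vol_pruned R GG0; rewrite -(volDl G0 v1) vol1 natrD.
    have := leq_deg_card G0 v; rewrite -(ler_nat R) -(ltr_nat R).
    move: m_gt0; rewrite -(ltr_nat R); lra.
  rewrite lt0n; have [->|[u /[dup] uGv /setDP[uG _] _]] := set_0Vmem (vset (G t) :\: [set v]).
    by rewrite /vol big_set0.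
  rewrite /vol (bigD1 u) //=; apply/(leq_trans _ (leq_addr _ _))/deg_ge.
  exact: (subsetP GG0).
have := cutP _ v1; rewrite vol1 => cut.
apply: le_trans (_ : phi / 6 * _ <= _); last first.
  by apply: le_trans cut _; rewrite ler_nat card_edges_between1.
rewrite mulrAC ler_wpM2l ?divr_ge0 ?(ltW phi_gt0) // ler_nat leq_min delta_le.
by rewrite deg_ge // (subsetP GG0).
Qed.
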